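(* Let $d\geq 2$ be an integer, let $c^{(d)}_{k,n}$ ($k\in\mathbb{Z}$, $n\in\mathbb{Z}_{\geq 0}$) be the entries of the Catalan triangle of order $d$, and let $b^{(d)}_{k,n}$ be the generalised binomial coefficients of order $d$. Then: 1. For every $n\geq 0$, $$[d]_q^n=\sum_{k>0}c_{k,n}^{(d)}[k]_q .$$ 2. For every $k\in\mathbb{Z}$ and $n\geq 0$, $$c_{k,n}^{(d)}=b_{k-1,n}^{(d)}-b_{k+1,n}^{(d)} .$$
   Context: Let $q$ be an indeterminate and, for an integer $k\geq 1$, let $[k]_q=\frac{q^k-q^{-k}}{q-q^{-1}}=q^{1-k}+q^{3-k}+\dots+q^{k-3}+q^{k-1}$. For $d\geq 2$, the generalised binomial coefficients $b^{(d)}_{k,n}$ ($k\in\mathbb{Z}$, $n\in\mathbb{Z}_{\geq 0}$) are the integers defined by $[d]_q^n=\sum_{k\in\mathbb{Z}}b_{k,n}^{(d)}q^k$. For $d\geq 2$, the Catalan triangle of order $d$ is the family of integers $c^{(d)}_{k,n}$ ($k\in\mathbb{Z}$, $n\in\mathbb{Z}_{\geq0}$) defined by the initial condition $c^{(d)}_{-1,0}=-1$, $c_{1,0}^{(d)}=1$, $c_{i,0}^{(d)}=0$ for all $i\neq-1,1$, and the recurrence $$c_{k,n+1}^{(d)}=c_{k-(d-1),n}^{(d)}+c_{k-(d-3),n}^{(d)}+\dots+c_{k+d-3,n}^{(d)}+c_{k+d-1,n}^{(d)}$$ (a sum of $d$ terms, with first indices in steps of $2$). For fixed $n$ only finitely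 many $c^{(d)}_{k,n}$ are non-zero. *)

(* Defs.v *)
From HB Require Import structures.
From mathcomp Require Import all_boot all_order all_algebra.
From mathcomp Require Import finmap.
From mathcomp Require Import all_classical.
From mathcomp Require Import zify ring.
Set Implicit Arguments.
Unset Strict Implicit.
Unset Printing Implicit Defensive.
Import Order.TTheory GRing.Theory Num.Theory.
Local Open Scope ring_scope.

(* The Laurent polynomial ring Z[q, q^-1] is viewed inside the field Q(q) of
   fractions of Z[q], where the quotient defining [k]_q makes sense. *)
Definition Qq := {fraction {poly int}}.

Definition q : Qq := FracField.tofrac 'X.

Definition qint (k : int) : Qq := (q ^ k - q ^ (- k)) / (q - q^-1).

Definition laurent (b : {fsfun int -> int with 0}) : Qq :=
  \sum_(k <- finsupp b) (b k)%:~R * q ^ k.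

Lemma q_neq0 : q != 0.
Proof. by rewrite tofrac_eq0 polyX_eq0. Qed.

Lemma qXn n : q ^ n%:Z = FracField.tofrac ('X^n).
Proof. by rewrite tofracXn. Qed.

Lemma qBqV_neq0 : q - q^-1 != 0.
Proof.
rewrite subr_eq0; apply/negP => /eqP e.
have : q ^ 2%:Z = q ^ 0%:Z.
  by rewrite -exprnP expr2 {1}e mulVf ?q_neq0.
rewrite !qXn => /eqP; rewrite tofrac_eq => /eqP /(congr1 (fun p => size (p : {poly int}))).
by rewrite !size_polyXn.
Qed.

Lemma laurent_poly (b : {fsfun int -> int with 0}) (N : nat) :
  (forall k, b k != 0 -> `|k| <= N%:Z) ->
  laurent b * q ^ N%:Z =
    FracField.tofrac (\poly_(i < (N + N).+1) b (i%:Z - N%:Z)).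
Proof.
move=> hb; pose s := map (fun i => i%:Z - N%:Z) (iota 0 (N + N).+1).
have us : uniq s.
  by rewrite map_inj_uniq ?iota_uniq // => i j /addIr [].
have -> : laurent b = \sum_(k <- s) (b k)%:~R * q ^ k.
  rewrite -(perm_big _ (uniq_perm (fset_uniq (seq_fset tt s)) us _)) /=; last first.
    by move=> k; exact: (seq_fsetE tt s k).
  rewrite /laurent; apply: (big_fset_incl _ (A := finsupp b) (B := seq_fset tt s)) => [|k].
    apply/fsubsetP => k; rewrite mem_finsupp seq_fsetE => /hb hk.
    apply/mapP; exists (absz (k + N%:Z)); first by rewrite mem_iota; lia.
    by lia.
  by move=> _; rewrite memNfinsupp => /eqP ->; rewrite mul0r.
rewrite big_map poly_def rmorph_sum -/(index_iota 0 (N + N).+1) big_mkord.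
rewrite mulr_suml; apply: eq_bigr => i _.
rewrite -mul_polyC rmorphM /= -qXn.
have -> c : FracField.tofrac (c%:P : {poly int}) = c%:~R :> Qq.
  by rewrite -[in LHS](intz c) !rmorph_int.
by rewrite -mulrA -expfzDr ?q_neq0 // subrK.
Qed.

Lemma laurent_inj : injective laurent.
Proof.
move=> b1 b2 e.
have bnd (b : {fsfun int -> int with 0}) : exists N : nat, forall k, b k != 0 -> `|k| <= N%:Z.
  exists (\max_(k <- finsupp b) absz k) => k kb.
  rewrite -abszE lez_nat; apply: (@leq_bigmax_seq _ _ xpredT (fun k => absz k)) => //.
  by rewrite mem_finsupp.
have [N1 h1] := bnd b1; have [N2 h2] := bnd b2.
have h1' k : b1 k != 0 -> `|k| <= (N1 + N2)%N%:Z by move=> /h1; lia.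
have h2' k : b2 k != 0 -> `|k| <= (N1 + N2)%N%:Z by move=> /h2; lia.
move: (congr1 (fun x => x * q ^ (N1 + N2)%N%:Z) e).
rewrite /= !laurent_poly // => /eqP; rewrite tofrac_eq => /eqP E.
apply/fsfunP => k; have [kN|kN] := boolP (`|k| <= (N1 + N2)%N%:Z).
  have [i [hi ->]] : exists i : nat,
      (i < ((N1 + N2) + (N1 + N2)).+1)%N /\ k = i%:Z - (N1 + N2)%N%:Z.
    by exists (absz (k + (N1 + N2)%N%:Z)); lia.
  by move: (congr1 (fun p : {poly int} => p`_i) E); rewrite /= !coef_poly hi.
case: (eqVneq (b1 k) 0) => [->|/h1']; last by rewrite (negPf kN).
by case: (eqVneq (b2 k) 0) => [->|/h2'] //; rewrite (negPf kN).
Qed.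

Lemma laurent_exists_poly (p : {poly int}) (N : nat) :
  exists b, FracField.tofrac p / q ^ N%:Z = laurent b.
Proof.
pose M := (N + size p)%N; pose p' := p * 'X^(size p).
pose s := map (fun i => i%:Z - M%:Z) (iota 0 (M + M).+1).
pose b : {fsfun int -> int with 0} :=
  [fsfun k in seq_fset tt s => p'`_(absz (k + M%:Z)) | 0].
have bk k : b k = if `|k| <= M%:Z then p'`_(absz (k + M%:Z)) else 0.
  rewrite fsfunE seq_fsetE; congr (if _ then _ else _).
  apply/mapP/idP => [[i]|hk]; first by rewrite mem_iota => ? ->; lia.
  by exists (absz (k + M%:Z)); rewrite ?mem_iota; lia.
exists b; apply: (mulIf (expfz_neq0 M%:Z q_neq0)); rewrite laurent_poly; last first.
  by move=> k; rewrite bk; case: ifP => //; rewrite eqxx.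
have -> : \poly_(i < (M + M).+1) b (i%:Z - M%:Z) = p'.
  apply/polyP => i; rewrite coef_poly bk.
  case: ifP => hi; last first.
    have sp := size_polyMleq p ('X^(size p) : {poly int}).
    rewrite nth_default //; apply: leq_trans sp _.
    rewrite size_polyXn; move: hi; rewrite /M; clear; move: (size _) => m; lia.
  by rewrite ifT ?subrK //; lia.
by rewrite /p' tofracM -qXn /M PoszD expfzDr ?q_neq0 // mulrA divfK // expfz_neq0 ?q_neq0.
Qed.

Lemma expz_subV (F : fieldType) (x : F) (d : nat) : x != 0 ->
  x ^ d%:Z - x ^ (- d%:Z) =
    (\sum_(i < d) x ^+ (2 * i)) / x ^ (d%:Z - 1) * (x - x^-1).
Proof.
move=> x0; have y0 := expfz_neq0 d%:Z x0.
have -> : x ^ (d%:Z - 1) = x ^ d%:Z / x by rewrite expfzDr.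
have e : (x ^ d%:Z) ^+ 2 - 1 = (x ^+ 2 - 1) * (\sum_(i < d) x ^+ (2 * i)).
  rewrite -exprnP exprAC subrX1; congr (_ * _).
  by apply: eq_bigr => i _; rewrite exprM.
rewrite -invr_expz; move: (x ^ d%:Z) (\sum_(i < d) _) y0 e => y S y0 e.
apply: (mulIf y0); rewrite mulrBl mulVf // -expr2 e; field.
by rewrite x0 y0.
Qed.

Lemma qint_poly (d : nat) :
  qint d = FracField.tofrac (\sum_(i < d) 'X^(2 * i)) / q ^ (d%:Z - 1).
Proof.
rewrite /qint expz_subV ?q_neq0 // mulfK ?qBqV_neq0 //; congr (_ / _).
by rewrite rmorph_sum; apply: eq_bigr => i _; rewrite rmorphXn.
Qed.

Lemma gbinom_subproof (d n : nat) : exists b, qint d ^+ n == laurent b.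
Proof.
have [->|d0] := posnP d.
  have -> : qint 0 ^+ n = FracField.tofrac ((n == 0%N)%:R) / q ^ 0%:Z.
    by rewrite /qint oppr0 subrr mul0r expr0n expr0z divr1 rmorph_nat.
  by have [b ->] := laurent_exists_poly (n == 0%N)%:R 0; exists b.
have [b hb] := laurent_exists_poly ((\sum_(i < d) 'X^(2 * i)) ^+ n) (d.-1 * n).
exists b; rewrite -hb qint_poly expr_div_n tofracXn.
by rewrite (_ : d%:Z - 1 = d.-1%:Z) -?exprnP -?exprM //; lia.
Qed.

(* The coefficient family of [d]_q^n; it is unique by laurent_inj. *)
Definition gbinom (d : nat) (k : int) (n : nat) : int :=
  xchoose (gbinom_subproof d n) k.

Lemma gbinomP (d n : nat) (b : {fsfun int -> int with 0}) :
  qint d ^+ n = laurent b <-> (forall k, b k = gbinom d k n).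
Proof.
rewrite (eqP (xchooseP (gbinom_subproof d n))); split => [e k|e].
  by rewrite /gbinom (laurent_inj e).
by congr laurent; apply/fsfunP => k; rewrite e.
Qed.

Fixpoint catalan_triangle (d : nat) (k : int) (n : nat) {struct n} : int :=
  match n with
  | 0 => if k == -1 then -1 else if k == 1 then 1 else 0
  | n'.+1 => \sum_(i < d) catalan_triangle d (k - (d%:Z - 1) + 2 * i%:Z) n'
  end.

Lemma catalan_triangle_eq0 (d : nat) (k : int) (n : nat) :
  (1 + n * d < absz k)%N -> catalan_triangle d k n = 0.
Proof.
elim: n k => [|n IHn] k hk /=.
  by rewrite !ifN //; apply/eqP; lia.
by rewrite big1 // => i _; apply: IHn; have := ltn_ord i; lia.
Qed.

(* Main.v *)
Require Import Defs.
From mathcomp Require Import all_boot all_order all_algebra.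
From mathcomp Require Import finmap.
From mathcomp Require Import all_classical.
From mathcomp Require Import zify.
Import GRing.Theory Num.Theory.
Local Open Scope classical_set_scope.
Local Open Scope ring_scope.

(** The recurrence of the Catalan triangle is multiplication by [d]_q read on
    coefficients: since [d]_q is the sum of the q ^ (d - 1 - 2 i) for i < d,
    multiplying a Laurent polynomial by [d]_q replaces its coefficient at k by
    the sum of its coefficients at k - (d - 1), k - (d - 3), ..., k + (d - 1).
    The coefficients of [d]_q ^ n obey this rule by definition ([gbinomS],
    which rests on the uniqueness of coefficients), hence so does the
    difference b_(k-1) - b_(k+1) of their translates.  At n = 0 this difference
    is 1 at k = 1, -1 at k = -1 and 0 elsewhere, which is the initial row of the
    triangle; this gives the second claim ([catalan_gbinom]).

    In terms of generating functions, the second claim says that the row n of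
    the triangle sums to
      sum_k c_k q^k = (q - q^-1) [d]_q ^ n.
    The rows are antisymmetric, c_(-k) = - c_k ([catalan_triangleN]), so the
    left-hand side is the sum over k > 0 of c_k (q^k - q^-k), that is,
    (q - q^-1) times the sum over k > 0 of c_k [k]_q.  Cancelling q - q^-1
    gives the first claim. *)

(** * Sums over the integers with bounded support *)

Definition window (N : nat) : seq int :=
  [seq i%:Z - N%:Z | i <- iota 0 (N + N).+1].

Lemma mem_window N k : (k \in window N) = (absz k <= N)%N.
Proof.
apply/mapP/idP => [[i]|hk]; first by rewrite mem_iota => ? ->; lia.
by exists (absz (k + N%:Z)); rewrite ?mem_iota; lia.
Qed.

Lemma fsum_window (V : nmodType) N (F : int -> V) :
    (forall k, (N < absz k)%N -> F k = 0) ->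
  \sum_(k \in [set: int]) F k = \sum_(k <- seq_fset tt (window N)) F k.
Proof.
move=> F0; apply: fsbigTE => k.
by rewrite seq_fsetE mem_window -ltnNge => /F0.
Qed.

(** The value at q of the family f of coefficients.  Indexing by a plain
    function, instead of a finitely supported one, makes translation of the
    exponents a mere change of variable. *)
Definition laurent_sum (f : int -> int) : Qq :=
  \sum_(k \in [set: int]) (f k)%:~R * q ^ k.

Lemma laurent_sumB N f g :
    (forall k, (N < absz k)%N -> f k = 0) ->
    (forall k, (N < absz k)%N -> g k = 0) ->
  laurent_sum (fun k => f k - g k) = laurent_sum f - laurent_sum g.
Proof.
move=> f0 g0; rewrite /laurent_sum !(@fsum_window _ N) -?sumrB.
- by apply: eq_bigr => k _; rewrite rmorphB mulrBl.
- by move=> k /g0 ->; rewrite mul0r.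
- by move=> k /f0 ->; rewrite mul0r.
- by move=> k hk; rewrite f0 // g0 // mul0r.
Qed.

Lemma laurent_sum_sum N d (F : 'I_d -> int -> int) :
    (forall i k, (N < absz k)%N -> F i k = 0) ->
  laurent_sum (fun k => \sum_(i < d) F i k) = \sum_(i < d) laurent_sum (F i).
Proof.
move=> F0; rewrite /laurent_sum (@fsum_window _ N); last first.
  by move=> k hk; rewrite big1 ?mul0r // => i _; apply: F0.
under [RHS]eq_bigr => i _.
  rewrite (@fsum_window _ N); last by move=> k /F0 ->; rewrite mul0r.
  over.
rewrite exchange_big; apply: eq_bigr => k _.
by rewrite rmorph_sum mulr_suml.
Qed.

Lemma laurent_sum_shift f j :
  laurent_sum (fun k => f (k + j)) = q ^ (- j) * laurent_sum f.
Proof.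
rewrite /laurent_sum mulr_fsumr [RHS](reindex_fsbigT (fun k => k + j)); last first.
  by exists (fun k => k - j) => k /=; lia.
apply: eq_fsbigr => k _.
by rewrite mulrCA -expfzDr ?q_neq0 // (addrC (- j)) addrK.
Qed.

Lemma laurentE b : laurent b = laurent_sum b.
Proof.
rewrite /laurent_sum (fsbigTE (finsupp b)) // => k.
by rewrite memNfinsupp => /eqP ->; rewrite mul0r.
Qed.

(** * Generalised binomial coefficients *)

Lemma gbinom_fsfun d n :
  exists b : {fsfun int -> int with 0}, forall k, b k = gbinom d k n.
Proof. by exists (xchoose (gbinom_subproof d n)). Qed.

Lemma gbinom_bounded d n :
  exists N : nat, forall k, (N < absz k)%N -> gbinom d k n = 0.
Proof.
have [b bE] := gbinom_fsfun d n.
exists (\max_(k <- finsupp b) absz k) => k; rewrite -bE.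
apply: contraTeq => kb; rewrite -leqNgt.
by apply: (@leq_bigmax_seq _ _ xpredT (fun k => absz k)); rewrite ?mem_finsupp.
Qed.

Lemma laurent_sum_gbinom (d n : nat) :
  laurent_sum (fun k => gbinom d k n) = qint d ^+ n.
Proof.
have [b bE] := gbinom_fsfun d n.
rewrite (proj2 (gbinomP d n b) bE) laurentE.
by congr laurent_sum; apply/funext => k; rewrite bE.
Qed.

(** This is how the coefficients of [d]_q ^ n are computed below: a family of
    integers is identified with them once its value at q is known, because a
    Laurent polynomial has only one family of coefficients. *)
Lemma gbinom_unique (d n N : nat) (f : int -> int) :
    (forall k, (N < absz k)%N -> f k = 0) ->
  qint d ^+ n = laurent_sum f -> forall k, f k = gbinom d k n.
Proof.
move=> f0 e.
pose b : {fsfun int -> int with 0} :=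
  [fsfun k in seq_fset tt (window N) => f k | 0].
have bf k : b k = f k.
  rewrite fsfunE seq_fsetE mem_window.
  by case: leqP => // /f0.
move=> k; rewrite -bf; move: k; apply/gbinomP.
by rewrite e laurentE; congr laurent_sum; apply/funext.
Qed.

Lemma gbinom0 d k : gbinom d k 0 = (k == 0)%:R.
Proof.
apply/esym; move: k; apply: (@gbinom_unique d 0 0) => [k k0|].
  by rewrite (_ : (k == 0) = false) //; lia.
rewrite expr0 /laurent_sum (fsbigTE [fset 0]%fset) => [|k].
  by rewrite big_seq_fset1 eqxx expr0z mulr1.
by rewrite inE => /negPf ->; rewrite mul0r.
Qed.

Lemma qint_sum (d : nat) : qint d%:Z = \sum_(i < d) q ^ (d%:Z - 1 - 2 * i%:Z).
Proof.
rewrite qint_poly rmorph_sum mulr_suml [RHS](reindex_inj rev_ord_inj) /=.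
apply: eq_bigr => i _.
rewrite -qXn invr_expz -expfzDr ?q_neq0 //; congr (q ^ _).
by have := ltn_ord i; lia.
Qed.

(** Both sides are coefficients of [d]_q * [d]_q ^ n: the factor
    q ^ (d - 1 - 2 i) of the i-th term of [d]_q moves the coefficient at
    k - (d - 1) + 2 i to k. *)
Lemma gbinomS d k n :
  gbinom d k n.+1 = \sum_(i < d) gbinom d (k - (d%:Z - 1) + 2 * i%:Z) n.
Proof.
have [N b0] := gbinom_bounded d n.
have vanish (i : 'I_d) l : (N + d < absz l)%N ->
    gbinom d (l - (d%:Z - 1) + 2 * i%:Z) n = 0.
  by move=> hl; apply: b0; have := ltn_ord i; lia.
apply/esym; move: k; apply: (@gbinom_unique d n.+1 (N + d)) => [k hk|].
  by rewrite big1 // => i _; apply: vanish.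
rewrite (@laurent_sum_sum (N + d)) // exprS {1}qint_sum mulr_suml.
apply: eq_bigr => i _.
rewrite -laurent_sum_gbinom.
rewrite -[d%:Z - 1 - 2 * i%:Z]opprK -laurent_sum_shift.
by congr laurent_sum; apply/funext => k; congr (gbinom d _ n); lia.
Qed.

(** * The Catalan triangle *)

Lemma catalan_gbinom d k n :
  catalan_triangle d k n = gbinom d (k - 1) n - gbinom d (k + 1) n.
Proof.
elim: n k => [|n IHn] k /=.
  rewrite !gbinom0 subr_eq0 addr_eq0.
  by case: (eqVneq k (-1)) => [->|_] //; case: eqP.
rewrite !gbinomS -sumrB; apply: eq_bigr => i _.
by rewrite IHn; congr (gbinom d _ n - gbinom d _ n); lia.
Qed.

(** The exponents of [d]_q are symmetric about 0, so each row inherits the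
    antisymmetry of the initial one. *)
Lemma catalan_triangleN d k n :
  catalan_triangle d (- k) n = - catalan_triangle d k n.
Proof.
elim: n k => [|n IHn] k /=.
  by do ![case: eqP => //]; lia.
rewrite (reindex_inj rev_ord_inj) -sumrN; apply: eq_bigr => i _ /=.
rewrite -IHn; congr (catalan_triangle d _ n).
by have := ltn_ord i; lia.
Qed.

(** Passing from b_k to b_(k-1) multiplies by q, and to b_(k+1) divides by q,
    so the difference in [catalan_gbinom] becomes the factor q - q^-1. *)
Lemma laurent_sum_catalan (d n : nat) :
  laurent_sum (fun k => catalan_triangle d k n) = (q - q^-1) * qint d ^+ n.
Proof.
have [N b0] := gbinom_bounded d n.
under [X in laurent_sum X]funext do rewrite catalan_gbinom.
rewrite (@laurent_sumB N.+1); last first.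
- by move=> k hk; apply: b0; lia.
- by move=> k hk; apply: b0; lia.
rewrite !(laurent_sum_shift (fun k => gbinom d k n)) laurent_sum_gbinom.
by rewrite opprK expr1z -mulrBl.
Qed.

(** The term at 0 vanishes and the terms at k and -k add up to
    c_k (q^k - q^-k) = (q - q^-1) c_k [k]_q. *)
Lemma laurent_sum_antisym N (c : int -> int) :
    (forall k, (N < absz k)%N -> c k = 0) -> (forall k, c (- k) = - c k) ->
  laurent_sum c =
    (q - q^-1) * \sum_(k \in [set k : int | 0 < k]) (c k)%:~R * qint k.
Proof.
move=> c0 cN.
rewrite mulr_fsumr fsbig_mkcond.
pose pos k : Qq := if 0 < k then (c k)%:~R * q ^ k else 0.
pose neg k : Qq := if 0 < k then (c k)%:~R * q ^ (- k) else 0.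
have pos0 k : (N < absz k)%N -> pos k = 0.
  by rewrite /pos => /c0 ->; rewrite mul0r if_same.
have neg0 k : (N < absz k)%N -> neg k = 0.
  by rewrite /neg => /c0 ->; rewrite mul0r if_same.
transitivity (\sum_(k \in [set: int]) (pos k - neg k)); last first.
  apply: eq_fsbigr => k _; rewrite /patch /pos /neg (_ : (k \in _) = (0 < k)) ?mem_setE //.
  case: ifP => _; last by rewrite subr0.
  by rewrite -mulrBr /qint mulrCA [X in _ = _ * X]mulrC divfK ?qBqV_neq0.
rewrite (@fsum_window _ N) => [|k hk]; last by rewrite pos0 // neg0 // subr0.
rewrite sumrB -!(@fsum_window _ N) //.
(* Replacing k by -k turns neg into the part of the sum over k < 0. *)
rewrite [X in _ - X](reindex_fsbigT -%R); last by exists -%R => k; rewrite opprK.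
have negN0 k : (N < absz k)%N -> neg (- k) = 0.
  by move=> hk; apply: neg0; rewrite abszN.
rewrite /laurent_sum !(@fsum_window _ N) //; last first.
  by move=> k /c0 ->; rewrite mul0r.
rewrite -sumrB; apply: eq_bigr => k _.
rewrite /pos /neg oppr_gt0 opprK cN.
case: (ltrgtP k 0) => k0.
- by rewrite sub0r rmorphN mulNr opprK.
- by rewrite subr0.
- have c00 : c 0 = 0 by have := cN 0; rewrite oppr0; move: (c 0) => x; lia.
  by rewrite k0 c00 mul0r subr0.
Qed.

Theorem proposition3p2 (d : nat) (hd : (2 <= d)%N) :
  (forall n : nat,
     qint d ^+ n =
       \sum_(k \in [set k : int | 0 < k]) (catalan_triangle d k n)%:~R * qint k) /\
  (forall (k : int) (n : nat),
     catalan_triangle d k n = gbinom d (k - 1) n - gbinom d (k + 1) n).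
Proof.
split=> [n|k n]; last exact: catalan_gbinom.
apply: (mulfI qBqV_neq0); rewrite -laurent_sum_catalan.
apply: (@laurent_sum_antisym (1 + n * d)) => k.
  exact: catalan_triangle_eq0.
exact: catalan_triangleN.
Qed.
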